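(* Let $\lambda$ and $\beta$ be positive random variables on a probability space $(\Omega,\mathcal F,\mathbb P)$ satisfying $$\mathbb E\left[\frac{\beta}{\lambda^{1/\beta}}\left(\frac{\beta+1}{\beta}\right)^{\frac{\beta+1}{\beta}}\right]<\infty,\qquad \mathbb E[\lambda]<\infty,\qquad \mathbb E[\lambda\beta]<\infty .$$ Let $F(t)=\mathbb E[H(t;\lambda,\beta)]$ be the CDF of the corresponding Kies mixture, and let $\overline F$ and $f$ be its CCDF and PDF. Then for every $t\in(0,1]$ $$\overline F(t)=\mathbb E\left[\overline H(t;\lambda,\beta)\right],\qquad f(t)=\mathbb E\left[h(t;\lambda,\beta)\right].$$
   Context: For constants $\lambda,\beta>0$ the Kies distribution on $(0,1)$ has, for $t\in(0,1)$, CDF $H(t;\lambda,\beta)=1-\exp\left(-\lambda\left(\frac{t}{1-t}\right)^\beta\right)$, complementary CDF $\overline H=1-H$, and PDF $h(t;\lambda,\beta)=\lambda\beta\frac{t^{\beta-1}}{(1-t)^{\beta+1}}\exp\left(-\lambda\left(\frac{t}{1-t}\right)^\beta\right)$. At $t=1$ these are extended by their limits: $H=1$, $\overline H=0$, $h=0$. For random $\lambda,\beta$ these are evaluated pointwise in $\omega$. The mixture CCDF is $\overline F=1-F$, and the mixture PDF is $f=F'$ (so in particular $F$ is differentiable on $(0,1)$); the value $f(1)$ is understood as the limit of $f(t)$ as $t\to1^-$. *)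

(* Defs.v *)
From HB Require Import structures.
From mathcomp Require Import all_boot all_order all_algebra.
From mathcomp Require Import all_classical all_reals all_analysis.

Set Implicit Arguments.
Unset Strict Implicit.
Unset Printing Implicit Defensive.

Import Order.TTheory GRing.Theory Num.Theory.
Import numFieldNormedType.Exports.

Local Open Scope classical_set_scope.
Local Open Scope ring_scope.

(* The Kies distribution is supported on (0, 1); its functions are extended to
   the real line by the values of a distribution with this support, which at
   t = 1 are also the limits from the left. *)
Definition kies_cdf {R : realType} (l b t : R) : R :=
  if t <= 0 then 0
  else if t < 1 then 1 - expR (- (l * (t / (1 - t)) `^ b))
  else 1.

Definition kies_ccdf {R : realType} (l b t : R) : R := 1 - kies_cdf l b t.

Definition kies_pdf {R : realType} (l b t : R) : R :=
  if (0 < t) && (t < 1) then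
    l * b * (t `^ (b - 1) / (1 - t) `^ (b + 1)) *
      expR (- (l * (t / (1 - t)) `^ b))
  else 0.

Section kies_mixture.
Context {d : measure_display} {T : measurableType d} {R : realType}.
Variables (P : probability T R) (lam beta : T -> R).

(* [fine] loses nothing for positive random variables: the integrand is then
   measurable with values in [0, 1]. *)
Definition kies_mixture_cdf (t : R) : R :=
  fine 'E_P[fun w => kies_cdf (lam w) (beta w) t].

Definition kies_mixture_ccdf (t : R) : R := 1 - kies_mixture_cdf t.

(* [derive1] and [lim] are total: they are meaningful only when the derivative,
   respectively the limit, exists. *)
Definition kies_mixture_pdf (t : R) : R :=
  if t == 1 then lim (derive1 kies_mixture_cdf x @[x --> (1 : R)^'-])
  else derive1 kies_mixture_cdf t.

End kies_mixture.

(* Main.v *)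
(* With s = t / (1 - t) and v = l * s `^ b, the Kies density is
   h(t) = b * v * e^-v / (t * (1 - t)).  For u <= t <= 1/2 we have s <= 1, so
   v <= l and h(t) <= (2 / u) * l * b.  For 1/2 <= t < 1, writing
   s = (v / l) `^ (1 / b) gives
   h(t) <= 4 * (b / l `^ (1 / b)) * v `^ p * e^-v with p = (b + 1) / b, and
   v `^ p * e^-v <= p `^ p.  The hypotheses say that both bounds are integrable,
   so one differentiates under the integral sign on ]u, 1[ and uses dominated
   convergence at t = 1, where h(t) --> 0 pointwise. *)
Require Import Defs.
From HB Require Import structures.
From mathcomp Require Import all_boot all_order all_algebra.
From mathcomp Require Import all_classical all_reals all_analysis.
From mathcomp Require Import measurable_realfun ring lra.
Set Implicit Arguments.
Unset Strict Implicit.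
Import Order.TTheory GRing.Theory Num.Theory.
Import numFieldNormedType.Exports.
Local Open Scope classical_set_scope.
Local Open Scope ring_scope.

(** * Pointwise identities and bounds for the Kies functions *)

Lemma powR_expRN_le (R : realType) (p v : R) : 0 < p -> 0 < v ->
  v `^ p * expR (- v) <= p `^ p.
Proof.
move=> p0 v0; rewrite /powR !gt_eqF// -expRD ler_expR.
have vp : 0 < v / p by rewrite divr_gt0.
(* On logarithms the goal is p * ln v - v <= p * ln p, which is ln (v / p) <= v / p multiplied by
   p. *)
have := ln_sublinear vp; rewrite ln_div ?posrE// => /ltW.
rewrite ler_pdivlMr//; lra.
Qed.

Lemma powR_div (R : realType) (x y b : R) : 0 <= x -> 0 <= y ->
  (x / y) `^ b = x `^ b / y `^ b.
Proof.
move=> x0 y0; rewrite powRM ?invr_ge0//; congr (_ * _).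
by rewrite -powR_inv1// -powRrM mulN1r powRN.
Qed.

Lemma powR_odds (R : realType) (b t : R) : 0 < t < 1 ->
  t `^ (b - 1) / (1 - t) `^ (b + 1) = (t / (1 - t)) `^ b / (t * (1 - t)).
Proof.
move=> /andP[t0 t1]; have t1' : 0 < 1 - t by rewrite subr_gt0.
rewrite powR_div ?ltW// powRB ?(gt_eqF t0) ?implybT// powRD ?(gt_eqF t1') ?implybT//.
rewrite !powRr1 ?ltW//; field.
by rewrite !gt_eqF// powR_gt0.
Qed.

Lemma kies_pdfE (R : realType) (l b t : R) : 0 < t < 1 ->
  kies_pdf l b t = l * b * ((t / (1 - t)) `^ b / (t * (1 - t))) *
    expR (- (l * (t / (1 - t)) `^ b)).
Proof. by move=> t01; rewrite /kies_pdf t01 powR_odds. Qed.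

Lemma kies_pdf_ge0 (R : realType) (l b t : R) : 0 <= l -> 0 <= b ->
  0 <= kies_pdf l b t.
Proof.
move=> l0 b0; rewrite /kies_pdf; case: ifP => // _.
by rewrite !mulr_ge0 ?invr_ge0 ?powR_ge0 ?expR_ge0.
Qed.

Lemma kies_cdf_itv01 (R : realType) (l b t : R) : 0 <= l ->
  0 <= kies_cdf l b t <= 1.
Proof.
move=> l0; rewrite /kies_cdf; case: ifP => _; first by rewrite lexx ler01.
case: ifP => _; last by rewrite ler01 lexx.
rewrite subr_ge0 gerBl expR_ge0 andbT -expR0 ler_expR oppr_le0.
by rewrite mulr_ge0// powR_ge0.
Qed.

Lemma is_derive_kies_cdf (R : realType) (l b t : R) : 0 < t < 1 ->
  is_derive t 1 (kies_cdf l b) (kies_pdf l b t).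
Proof.
move=> /[dup] t01 /andP[t0 t1].
have t1' : 0 < 1 - t by rewrite subr_gt0.
have s0 : 0 < t / (1 - t) by rewrite divr_gt0.
(* Near an interior point only the middle branch of [kies_cdf] is active. *)
apply: (@near_eq_is_derive R R^o R^o
  (fun x => 1 - expR (- (l * (x / (1 - x)) `^ b)))).
  near=> x; rewrite /kies_cdf ifF; last first.
    by apply/negbTE; rewrite -ltNge; near: x; exact: lt_nbhsr.
  by rewrite ifT//; near: x; exact: lt_nbhsl.
have d1 : is_derive t 1 (fun x : R => 1 - x) (-1).
  by rewrite -[-1]sub0r; exact: is_deriveB.
have dV : is_derive t 1 (fun x : R => (1 - x)^-1) ((1 - t) ^- 2).
  have := @is_deriveV R (fun x => 1 - x) t (-1) 1 (lt0r_neq0 t1') d1.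
  by rewrite scalerN scaleNr opprK; rewrite /GRing.scale/= mulr1.
have ds : is_derive t 1 (fun x : R => x / (1 - x)) ((1 - t) ^- 2).
  apply: is_derive_eq.
  rewrite /GRing.scale/= mulr1; field; exact: lt0r_neq0.
have dp : is_derive t 1 (fun x : R => (x / (1 - x)) `^ b)
    (b * (t / (1 - t)) `^ (b - 1) * (1 - t) ^- 2).
  apply: (@is_derive1_comp _ (fun y => y `^ b) (fun x => x / (1 - x))).
  by apply: is_derive1_powR.
have dl : is_derive t 1 (fun x : R => - (l * (x / (1 - x)) `^ b))
    (- (l * (b * (t / (1 - t)) `^ (b - 1) * (1 - t) ^- 2))).
  by apply: is_deriveN; exact: is_deriveZ.
have de := @is_derive1_comp _ expR _ _ _ _ (is_derive_expR _) dl.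
have dB := is_deriveB (is_derive_cst (1 : R) t 1) de.
apply: (is_derive_eq dB).
(* With s = t / (1 - t), the chain rule factor s [^ (b - 1) / (1 - t)^2 equals s]^ b / (t * (1 -
   t)). *)
rewrite kies_pdfE// powRB ?(gt_eqF s0) ?implybT// powRr1 ?ltW//; field.
by rewrite !gt_eqF.
Unshelve. all: by end_near. Qed.

Lemma kies_pdf_le_left (R : realType) (l b u t : R) : 0 < l -> 0 < b ->
  0 < u -> u <= t <= 2^-1 -> kies_pdf l b t <= 2 / u * (l * b).
Proof.
move=> l0 b0 u0 /andP[ut t2].
have t01 : 0 < t < 1 by apply/andP; split; lra.
have t0 : 0 < t by lra.
have t1' : 0 < 1 - t by lra.
rewrite kies_pdfE// -mulrA [leRHS]mulrC ler_pM2l ?mulr_gt0//.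
rewrite -[leRHS]mulr1 ler_pM ?expR_ge0//.
- by rewrite divr_ge0 ?powR_ge0// mulr_ge0 ?ltW.
- apply: (@le_trans _ _ (1 / (t * (1 - t)))).
    rewrite ler_pM2r ?invr_gt0 ?mulr_gt0//.
    have b1 : 1 `^ b = 1 :> R by rewrite powR1.
    rewrite -[leRHS]b1 ge0_ler_powR ?nnegrE ?divr_ge0 ?(ltW t0) ?(ltW t1') ?(ltW b0)//.
    by rewrite ler_pdivrMr//; lra.
  (* Since t >= u and 1 - t >= 1/2, the product t * (1 - t) is at least u / 2. *)
  rewrite ler_pdivrMr ?mulr_gt0// mulrAC ler_pdivlMr//; nra.
- by rewrite -expR0 ler_expR oppr_le0 mulr_ge0 ?powR_ge0 ?ltW.
Qed.

(** Because v [^ (1 / b) = l]^ (1 / b) * t / (1 - t), raising the exponent of v from 1 to 1 + 1 / b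
    absorbs the factor 1 / (1 - t), singular at 1. What remains outside v is [t ^- 2], which is
    bounded near 1. *)
Lemma kies_pdfE_odds (R : realType) (l b t : R) : 0 < l -> 0 < b -> 0 < t < 1 ->
  let v := l * (t / (1 - t)) `^ b in
  kies_pdf l b t =
  t ^- 2 * (b / l `^ (1 / b)) * (v `^ ((b + 1) / b) * expR (- v)).
Proof.
move=> l0 b0 /[dup] t01 /andP[t0 t1] /=; rewrite kies_pdfE//.
have t1' : 0 < 1 - t by rewrite subr_gt0.
have s0 : 0 < t / (1 - t) by rewrite divr_gt0.
set s := t / (1 - t) in s0 *.
have -> : (b + 1) / b = 1 + 1 / b by field; exact: lt0r_neq0.
set v := l * s `^ b; have v0 : 0 < v by rewrite mulr_gt0 ?powR_gt0.
rewrite powRD ?(gt_eqF v0) ?implybT// powRr1 ?(ltW v0)//.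
have -> : v `^ (1 / b) = l `^ (1 / b) * s.
  rewrite /v powRM ?powR_ge0 ?ltW// -powRrM mulrC.
  by rewrite mulrCA mulfV ?gt_eqF// mulr1 powRr1 ?ltW// mulrC.
rewrite /v /s; field.
by rewrite !gt_eqF// powR_gt0.
Qed.

(** The constant 4 bounds [t ^- 2] for t >= 1/2; the factor it multiplies is the integrand of the
    first moment hypothesis. *)
Lemma kies_pdf_le_right (R : realType) (l b t : R) : 0 < l -> 0 < b ->
  2^-1 <= t < 1 ->
  kies_pdf l b t <=
  4 * (b / l `^ (1 / b) * ((b + 1) / b) `^ ((b + 1) / b)).
Proof.
move=> l0 b0 /andP[t2 t1]; have t0 : 0 < t by lra.
have t1' : 0 < 1 - t by rewrite subr_gt0.
rewrite kies_pdfE_odds ?t0// mulrA.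
rewrite ler_pM ?powR_expRN_le//.
- by rewrite mulr_ge0 ?invr_ge0 ?sqr_ge0 ?divr_ge0 ?powR_ge0 ?ltW.
- by rewrite mulr_ge0 ?powR_ge0 ?expR_ge0.
- rewrite ler_pM2r ?divr_gt0 ?powR_gt0//.
  by rewrite -[leLHS]mul1r ler_pdivrMr ?exprn_gt0//; nra.
- by rewrite divr_gt0// ltr_wpDr.
- by rewrite mulr_gt0 ?powR_gt0 ?divr_gt0.
Qed.

(** Needed to compose with [powR_cvg0], whose argument tends to 0 from the right. *)
Lemma cvg_gt_at_right (T : Type) (F : set_system T) (R : realType)
    (f : T -> R) (l : R) : Filter F ->
  f x @[x --> F] --> l -> (\forall x \near F, l < f x) ->
  f x @[x --> F] --> l^'+.
Proof. by move=> FF fl lf A /fl; apply: filterS2 lf => x lfx; exact. Qed.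

Lemma cvg_kies_pdf1 (R : realType) (l b : R) : 0 < l -> 0 < b ->
  kies_pdf l b t @[t --> (1 : R)^'-] --> (0 : R).
Proof.
move=> l0 b0.
(* One more power of v in the exponential bound leaves a factor 1 / v --> 0. *)
set p := (b + 1) / b; have p0 : 0 < p by rewrite divr_gt0// ltr_wpDr.
pose C := 4 * (b / l `^ (1 / b)) * (p + 1) `^ (p + 1) / l.
have lim0 : C * ((1 - t) / t) `^ b @[t --> (1 : R)^'-] --> (0 : R).
  rewrite -(mulr0 C); apply: cvgMl_tmp => //.
  apply: (cvg_comp (fun t => (1 - t) / t) _ _ (powR_cvg0 b0)).
  apply: cvg_gt_at_right.
    apply: cvg_at_left_filter.
    have -> : 0 = (1 - 1) / 1 :> R by rewrite subrr mul0r.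
    apply: cvgM; first by apply: cvgB; [exact: cvg_cst|exact: cvg_id].
    by apply: cvgV; [exact: oner_neq0|exact: cvg_id].
  near=> t.
  have t0 : 0 < t by near: t; apply: nbhs_left_gt.
  have t1 : t < 1 by near: t; exact: nbhs_left_lt.
  by rewrite divr_gt0// subr_gt0.
apply: (@squeeze_cvgr _ _ _ _ (cst 0) _ _ _ _ _ lim0); last exact: cvg_cst.
near=> t; rewrite kies_pdf_ge0 ?(ltW l0) ?(ltW b0)//=.
have t2 : 2^-1 <= t by near: t; apply: nbhs_left_ge; lra.
have t1 : t < 1 by near: t; exact: nbhs_left_lt.
have t0 : 0 < t by lra.
have t1' : 0 < 1 - t by rewrite subr_gt0.
rewrite kies_pdfE_odds ?t0//.
set v := l * _ `^ b; have v0 : 0 < v by rewrite mulr_gt0 ?powR_gt0 ?divr_gt0.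
have -> : C * ((1 - t) / t) `^ b =
    4 * (b / l `^ (1 / b)) * ((p + 1) `^ (p + 1) / v).
  rewrite /C /v !powR_div ?ltW//; field.
  by rewrite !gt_eqF ?powR_gt0.
rewrite ler_pM//.
- by rewrite mulr_ge0 ?invr_ge0 ?sqr_ge0 ?divr_ge0 ?powR_ge0 ?ltW.
- by rewrite mulr_ge0 ?powR_ge0 ?expR_ge0.
- rewrite ler_pM2r ?divr_gt0 ?powR_gt0//.
  by rewrite -[leLHS]mul1r ler_pdivrMr ?exprn_gt0//; nra.
- have := powR_expRN_le (addr_gt0 p0 ltr01) v0.
  rewrite powRD ?(gt_eqF v0) ?implybT// powRr1 ?(ltW v0)//.
  by rewrite ler_pdivlMr// mulrAC.
Unshelve. all: by end_near. Qed.

(** Adding the two nonnegative bounds gives one bound free of t on all of [u, 1[, whose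
    integrability follows by linearity. *)
Lemma kies_pdf_le (R : realType) (l b u t : R) : 0 < l -> 0 < b ->
  0 < u -> u <= t < 1 ->
  kies_pdf l b t <=
  4 * (b / l `^ (1 / b) * ((b + 1) / b) `^ ((b + 1) / b)) + 2 / u * (l * b).
Proof.
move=> l0 b0 u0 /andP[ut t1].
have B0 : 0 <= 4 * (b / l `^ (1 / b) * ((b + 1) / b) `^ ((b + 1) / b)).
  by rewrite !mulr_ge0 ?invr_ge0 ?powR_ge0 ?ltW.
have [t2|t2] := leP 2^-1 t.
  rewrite (le_trans (kies_pdf_le_right l0 b0 _)) ?t2 ?lerDl//.
  by rewrite !mulr_ge0 ?invr_ge0 ?ltW.
by rewrite (le_trans (kies_pdf_le_left l0 b0 u0 _)) ?ut ?(ltW t2)// lerDr.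
Qed.

(** * Measurability in the random parameters *)

Section measurability.
Context d (T : measurableType d) (R : realType).
Implicit Types f g : T -> R.

(** Base and exponent both vary; positivity of the base allows writing the power as exp (g * ln f),
    away from the special case of [powR] at base 0. *)
Lemma measurable_fun_powR_gt0 f g : (forall x, 0 < f x) ->
  measurable_fun setT f -> measurable_fun setT g ->
  measurable_fun setT (fun x => f x `^ g x).
Proof.
move=> f0 mf mg.
rewrite (_ : (fun x => _) = expR \o (fun x => g x * ln (f x))).
  by apply: measurableT_comp => //; apply: measurable_funM => //;
    exact: measurableT_comp.
by apply/funext => x /=; rewrite /powR gt_eqF.
Qed.

Lemma measurable_fun_inv_gt0 f : (forall x, 0 < f x) ->
  measurable_fun setT f -> measurable_fun setT (fun x => (f x)^-1).
Proof.
move=> f0 mf; rewrite (_ : (fun x => _) = (fun x => f x `^ (-1))).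
  exact: measurable_fun_powR_gt0.
by apply/funext => x; rewrite powR_inv1 ?ltW.
Qed.

Variables (l b : T -> R).
Hypotheses (ml : measurable_fun setT l) (mb : measurable_fun setT b).

Let measurable_expR_odds t : 0 < t < 1 ->
  measurable_fun setT (fun w => expR (- (l w * (t / (1 - t)) `^ b w))).
Proof.
move=> /andP[t0 t1]; apply: measurableT_comp => //.
apply: measurableT_comp => //; apply: measurable_funM => //.
by apply: measurable_fun_powR_gt0 => // _; rewrite divr_gt0// subr_gt0.
Qed.

Lemma measurable_kies_cdf t : measurable_fun setT (fun w => kies_cdf (l w) (b w) t).
Proof.
rewrite /kies_cdf; have [_|t0] := leP t 0; first exact: measurable_cst.
have [t1|_] := ltP t 1; last exact: measurable_cst.
by apply: measurable_funB => //; apply: measurable_expR_odds; rewrite t0.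
Qed.

Lemma measurable_kies_pdf t : measurable_fun setT (fun w => kies_pdf (l w) (b w) t).
Proof.
rewrite /kies_pdf; have [/[dup] t01 /andP[t0 t1]|_] := boolP (0 < t < 1);
  last exact: measurable_cst.
apply: measurable_funM; last exact: measurable_expR_odds.
apply: measurable_funM; first exact: measurable_funM.
apply: measurable_funM.
  by apply: measurable_fun_powR_gt0 => //; exact: measurable_funB.
have t1' : 0 < 1 - t by rewrite subr_gt0.
apply: measurable_fun_inv_gt0 => [w|]; first exact: powR_gt0.
by apply: measurable_fun_powR_gt0 => //; exact: measurable_funD.
Qed.

End measurability.

(** For a nonnegative variable the expectation is also the integral of its absolute value, so
    finiteness is integrability. *)
Lemma ge0_integrable_expectation (d : measure_display) (T : measurableType d)
    (R : realType) (P : probability T R) (X : T -> R) :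
  (forall w, 0 <= X w) -> measurable_fun setT X -> ('E_P[X] < +oo)%E ->
  P.-integrable setT (EFin \o X).
Proof.
move=> X0 mX EX; apply/integrableP; split; first exact/measurable_EFinP.
under eq_integral do rewrite /= ger0_norm//.
by move: EX; rewrite unlock.
Qed.

(** * Differentiation under the expectation and the limit at 1 *)

Section kies_mixture.
Context d (T : measurableType d) (R : realType) (P : probability T R).
Variables lam beta : {RV P >-> R}.
Implicit Types t u : R.
Hypotheses (lam_gt0 : forall w, 0 < lam w) (beta_gt0 : forall w, 0 < beta w).
Hypothesis Ebound : ('E_P[fun w : T => (beta w / lam w `^ (1 / beta w) *
  ((beta w + 1) / beta w) `^ ((beta w + 1) / beta w))%R] < +oo)%E.
Hypothesis Elambeta : ('E_P[fun w : T => (lam w * beta w)%R] < +oo)%E.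

Let ml : measurable_fun setT lam. Proof. exact: measurable_funPT. Qed.
Let mb : measurable_fun setT beta. Proof. exact: measurable_funPT. Qed.

(** The bound of [kies_pdf_le] as a random variable: it dominates the densities at all points of [u,
    1[ at once. [Ebound] controls the first summand and [Elambeta] the second. *)
Let G (u : R) (w : T) : R := 4 * (beta w / lam w `^ (1 / beta w) *
  ((beta w + 1) / beta w) `^ ((beta w + 1) / beta w)) +
  2 / u * (lam w * beta w).

Let G_ge0 u w : 0 < u -> 0 <= G u w.
Proof.
move=> u0; rewrite addr_ge0// !mulr_ge0 ?invr_ge0 ?powR_ge0 ?(ltW u0)//.
all: by rewrite ltW.
Qed.

Let integrable_G u : P.-integrable setT (EFin \o G u).
Proof.
have mp : measurable_fun setT (fun w => (beta w + 1) / beta w).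
  apply: measurable_funM; first exact: measurable_funD.
  exact: measurable_fun_inv_gt0.
rewrite (_ : EFin \o G u = (fun w => 4%:E * (beta w / lam w `^ (1 / beta w) *
  ((beta w + 1) / beta w) `^ ((beta w + 1) / beta w))%:E)%E \+
  (fun w => (2 / u)%:E * (lam w * beta w)%:E)%E)//.
apply: integrableD => //; apply: integrableZl => //.
  apply: ge0_integrable_expectation => //.
    by move=> w; rewrite !mulr_ge0 ?invr_ge0 ?powR_ge0 ?ltW.
  apply: measurable_funM; last first.
    apply: measurable_fun_powR_gt0 => // w.
    by rewrite divr_gt0// ltr_wpDr.
  apply: measurable_funM => //; apply: measurable_fun_inv_gt0.
    by move=> w; rewrite powR_gt0.
  apply: measurable_fun_powR_gt0 => //; apply: measurable_funM => //.
  exact: measurable_fun_inv_gt0.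
apply: ge0_integrable_expectation => //.
  by move=> w; rewrite mulr_ge0 ?ltW.
exact: measurable_funM.
Qed.

Let kies_pdf_leG u t w : 0 < u -> u <= t < 1 ->
  `|kies_pdf (lam w) (beta w) t| <= G u w.
Proof.
move=> u0 ut; have l0 := lam_gt0 w; have b0 := beta_gt0 w.
rewrite ger0_norm ?kies_pdf_ge0 ?(ltW l0) ?(ltW b0)//; exact: kies_pdf_le.
Qed.

Lemma integrable_kies_cdf t :
  P.-integrable setT (fun w => (kies_cdf (lam w) (beta w) t)%:E).
Proof.
apply: (le_integrable measurableT _ _
  (finite_measure_integrable_cst P 1 measurableT)).
  exact/measurable_EFinP/measurable_kies_cdf.
move=> w _; rewrite /= lee_fin normr1.
have /andP[c0 c1] := kies_cdf_itv01 (beta w) t (ltW (lam_gt0 w)).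
by rewrite ger0_norm.
Qed.

Lemma integrable_kies_pdf t : 0 < t ->
  P.-integrable setT (fun w => (kies_pdf (lam w) (beta w) t)%:E).
Proof.
(* For a single point t < 1 one may take u = t; from 1 on the density is 0. *)
move=> t0; apply: (le_integrable measurableT _ _ (integrable_G t)).
  exact/measurable_EFinP/measurable_kies_pdf.
move=> w _; rewrite /= lee_fin [leRHS]ger0_norm ?G_ge0//.
have [t1|t1] := ltP t 1; first by rewrite kies_pdf_leG ?lexx.
by rewrite /kies_pdf (ltNge t 1) t1 andbF normr0 G_ge0.
Qed.

Lemma kies_mixture_cdfE : kies_mixture_cdf P lam beta =
  fun t => (\int[P]_w kies_cdf (lam w) (beta w) t)%R.
Proof. by apply/funext => t; rewrite /kies_mixture_cdf unlock. Qed.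

Lemma is_derive_kies_mixture_cdf t : 0 < t < 1 ->
  is_derive t 1 (kies_mixture_cdf P lam beta)
    (\int[P]_w kies_pdf (lam w) (beta w) t)%R.
Proof.
move=> /andP[t0 t1]; rewrite kies_mixture_cdfE.
(* Domination must hold on an open interval around t, and [G u] needs it to stay away from 0; any u
   strictly between 0 and t serves. *)
pose u := t / 2; have u0 : 0 < u by rewrite divr_gt0.
pose f t w := kies_cdf (lam w) (beta w) t.
have I01 x : x \in `]u, 1[ -> u < x < 1 /\ 0 < x < 1.
  by rewrite in_itv/= => /andP[ux ->]; rewrite ux (lt_trans u0).
have It : t \in `]u, 1[ by rewrite in_itv/= t1 andbT /u; lra.
have intf x : `]u, 1[%classic x -> P.-integrable setT (EFin \o f x).
  by move=> _; exact: integrable_kies_cdf.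
have df x w : `]u, 1[%classic x -> setT w -> derivable (f ^~ w) x 1.
  by move=> /I01[_ x01] _; case: (is_derive_kies_cdf (lam w) (beta w) x01).
have d1f x w : x \in `]u, 1[ -> partial1of2 f x w = kies_pdf (lam w) (beta w) x.
  move=> /I01[_ x01]; rewrite partial1of2E.
  by case: (is_derive_kies_cdf (lam w) (beta w) x01).
have fG x w : `]u, 1[%classic x -> setT w -> `|partial1of2 f x w| <= G u w.
  move=> Ix _; rewrite d1f//; have [/andP[ux x1] _] := I01 _ Ix.
  by rewrite kies_pdf_leG ?(ltW ux).
have G0 w : 0 <= G u w by exact: G_ge0.
apply: DeriveDef.
  exact: (derivable_under_integral measurableT It intf df G0 (integrable_G u) fG).
rewrite -derive1E.
rewrite (differentiation_under_integral measurableT It intf df G0 (integrable_G u) fG).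
by apply: eq_Rintegral => w _; rewrite -d1f.
Qed.

Lemma cvg_Rintegral_kies_pdf1 :
  (\int[P]_w kies_pdf (lam w) (beta w) t)%R @[t --> (1 : R)^'-] --> (0 : R).
Proof.
(* Dominated convergence concerns sequences, so the limit is tested along sequences below 1 that
   tend to 1. *)
apply/cvg_at_leftP => t [t1 cvgt].
have /= : \forall n \near \oo, 2^-1 <= t n.
  by apply: (cvgr_ge 1) => //; lra.
case=> N _ tN.
(* Domination is required at every index: dropping the first N terms leaves only points in [1/2, 1[,
   where [G 2^-1] applies. *)
rewrite -(cvg_shiftn N); apply: fine_cvg.
rewrite -[X in _ --> X](integral0 P setT).
apply: (@dominated_cvg _ _ _ P setT measurableT _ _ (EFin \o G 2^-1)) => //=.
- by move=> n; exact/measurable_EFinP/measurable_kies_pdf.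
- move=> w _; apply: cvg_EFin; first exact: nearW.
  have /cvg_at_leftP := cvg_kies_pdf1 (lam_gt0 w) (beta_gt0 w).
  move=> /(_ t (conj t1 cvgt)) h.
  by have := h; rewrite -(cvg_shiftn N).
- move=> n w _; rewrite lee_fin kies_pdf_leG//.
  by rewrite t1 andbT tN//= leq_addl.
Qed.

Lemma cvg_derive1_kies_mixture_cdf1 :
  derive1 (kies_mixture_cdf P lam beta) x @[x --> (1 : R)^'-] --> (0 : R).
Proof.
apply: cvg_trans cvg_Rintegral_kies_pdf1; apply: near_eq_cvg.
near=> t; rewrite derive1E.
have t0 : 0 < t by near: t; exact: nbhs_left_gt.
have t1 : t < 1 by near: t; exact: nbhs_left_lt.
by case: (@is_derive_kies_mixture_cdf t _) => [|_ ->]; rewrite ?t0.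
Unshelve. all: by end_near. Qed.

End kies_mixture.

Unset Implicit Arguments.
Set Strict Implicit.

Theorem corollary3p5 (d : measure_display) (T : measurableType d)
  (R : realType) (P : probability T R) (lam beta : {RV P >-> R})
  (lam_gt0 : forall w : T, 0 < lam w)
  (beta_gt0 : forall w : T, 0 < beta w)
  (Ebound : ('E_P[fun w : T => (beta w / lam w `^ (1 / beta w) *
      ((beta w + 1) / beta w) `^ ((beta w + 1) / beta w))%R] < +oo)%E)
  (Elam : ('E_P[lam] < +oo)%E)
  (Elambeta : ('E_P[fun w : T => (lam w * beta w)%R] < +oo)%E) :
  [/\ forall t : R, 0 < t < 1 -> derivable (kies_mixture_cdf P lam beta) t 1,
      cvg (derive1 (kies_mixture_cdf P lam beta) x @[x --> (1 : R)^'-])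
    & forall t : R, 0 < t <= 1 ->
      ((kies_mixture_ccdf P lam beta t)%:E =
         'E_P[fun w : T => kies_ccdf (lam w) (beta w) t])%E /\
      ((kies_mixture_pdf P lam beta t)%:E =
         'E_P[fun w : T => kies_pdf (lam w) (beta w) t])%E].

Proof.
(* The first two components certify that the derivative and the limit entering [kies_mixture_pdf]
   exist. *)
split=> [t t01||t /andP[t0 t1]].
- by case: (is_derive_kies_mixture_cdf lam_gt0 beta_gt0 Ebound Elambeta t01).
- apply/cvg_ex; exists 0.
  exact: (cvg_derive1_kies_mixture_cdf1 lam_gt0 beta_gt0 Ebound Elambeta).
split.
  (* Integrability of the CDF makes [fine] harmless; then 1 is the expectation of the constant 1 and
     linearity applies. *)
  rewrite /kies_mixture_ccdf EFinB /kies_mixture_cdf fineK; last first.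
    by rewrite unlock integrable_fin_num//; exact: integrable_kies_cdf.
  rewrite -(expectation_cst P 1) -expectationB//.
    exact: Lfun_cst.
  by apply/Lfun1_integrable; exact: integrable_kies_cdf.
(* At t = 1 both sides vanish: the left limit is 0, and [kies_pdf] is 0 there by its default
   branch. *)
rewrite /kies_mixture_pdf; case: eqVneq => [->|t_neq1].
  have /cvg_lim -> // :=
    cvg_derive1_kies_mixture_cdf1 lam_gt0 beta_gt0 Ebound Elambeta.
  rewrite -(expectation_cst P 0); congr expectation; apply/funext => w /=.
  by rewrite /kies_pdf ltxx andbF.
have t01 : 0 < t < 1 by rewrite t0 lt_neqAle t_neq1.
rewrite derive1E.
have [_ ->] := is_derive_kies_mixture_cdf lam_gt0 beta_gt0 Ebound Elambeta t01.
rewrite /Rintegral fineK ?unlock//.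
by apply: integrable_fin_num => //; exact: integrable_kies_pdf.
Qed.
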